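(* The Bessel--Stirling number of the second kind $\mathsf S_2(n,k)$ counts the number of ways to arrange $n$ labeled marbles (placed one at a time in the order $1,2,\dots,n$) in $k$ total compartments distributed across urns with two unlabeled compartments each, subject to the following constraints: - a marble may be placed in any compartment of any urn to begin; - another marble cannot be placed in an urn's used compartment until the other compartment of that urn also contains at least one marble; - marbles may be freely placed in any compartment of urns where both compartments have been used; - a new urn cannot be opened until both compartments of all previously used urns contain at least one marble each. Here both the urns and the two compartments within each urn are indistinguishable: two placements count as the same arrangement precisely when one is obtained from the other by permuting urns and by swapping the compartments within urns; unused compartments (including the empty partner compartment of a partially filled urn) are suppressed; and $k$ counts the non-empty compartments. Equivalently, one may order the urns, and the compartments within each urn, canonically by first use, the constraints then making ''open a new compartment'' a single well-defined move at every step. Consequently, the Bessel--Bell number $B^{(2)}_n$ counts the total number of such placements of $n$ labeled marbles, over all $k$.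
   Context: $\mathsf S_2(n,k)$ is defined for $n,k\ge0$ by $\mathsf S_2(0,k)=\delta_{0,k}$, the convention $\mathsf S_2(n,k)=0$ for $k<0$, and $\mathsf S_2(n+1,k)=2\lfloor k/2\rfloor\,\mathsf S_2(n,k)+\mathsf S_2(n,k-1)$. The Bessel--Bell numbers $(B^{(2)}_n)_{n\ge0}$ (OEIS A007472) are the unique solution of $a_{n+2}=\sum_{k=0}^n\binom nk2^{\,n-k}a_k$ $(n\ge0)$ with $a_0=a_1=1$. *)

(* Defs.v *)
From mathcomp Require Import all_boot.
From mathcomp Require Import perm.

Set Implicit Arguments.
Unset Strict Implicit.
Unset Printing Implicit Defensive.

(* The missing summand for [k = 0] is the convention [S2 n (-1) = 0]. *)
Fixpoint S2 (n k : nat) : nat :=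
  match n with
  | 0 => k == 0
  | n'.+1 => 2 * k./2 * S2 n' k + (if k is k'.+1 then S2 n' k' else 0)
  end.

Definition is_bessel_bell (a : nat -> nat) : Prop :=
  [/\ a 0 = 1, a 1 = 1
    & forall n, a n.+2 = \sum_(k < n.+1) 'C(n, k) * 2 ^ (n - k) * a k].

(* [bessel_bell_prefix n] lists the terms of index 0, ..., n.+1. *)
Fixpoint bessel_bell_prefix (n : nat) : seq nat :=
  match n with
  | 0 => [:: 1; 1]
  | n'.+1 =>
      let s := bessel_bell_prefix n' in
      rcons s (\sum_(k < n'.+1) 'C(n', k) * 2 ^ (n' - k) * nth 0 s k)
  end.

Definition bessel_bell (n : nat) : nat := nth 0 (bessel_bell_prefix n) n.

Lemma size_bessel_bell_prefix n : size (bessel_bell_prefix n) = n.+2.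
Proof. by elim: n => //= n IHn; rewrite size_rcons IHn. Qed.

Lemma nth_bessel_bell_prefix n k :
  k < n.+2 -> nth 0 (bessel_bell_prefix n) k = bessel_bell k.
Proof.
have step j i : i < j.+2 ->
    nth 0 (bessel_bell_prefix j.+1) i = nth 0 (bessel_bell_prefix j) i.
  by move=> ij; rewrite /= nth_rcons size_bessel_bell_prefix ij.
have up j d : nth 0 (bessel_bell_prefix (j + d)) j = bessel_bell j.
  elim: d => [|d IHd]; first by rewrite addn0.
  by rewrite addnS step // !ltnS ltnW // ltnS leq_addr.
rewrite ltnS leq_eqVlt => /orP[/eqP-> | ltkn].
  by rewrite -step.
by rewrite -(subnKC (ltnSE ltkn)) up.
Qed.

Lemma bessel_bellP : is_bessel_bell bessel_bell.
Proof.
split=> // n; rewrite -(@nth_bessel_bell_prefix n.+1 n.+2) //=.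
rewrite nth_rcons size_bessel_bell_prefix ltnn eqxx.
by apply: eq_bigr => k _; rewrite nth_bessel_bell_prefix // ltnW // ltnS.
Qed.

Lemma bessel_bell_unique (a : nat -> nat) :
  is_bessel_bell a -> a =1 bessel_bell.
Proof.
case=> a0 a1 aS n; have [b0 b1 bS] := bessel_bellP.
elim/ltn_ind: n => -[|[|n]] IHn; rewrite ?a0 ?a1 // aS bS.
by apply: eq_bigr => k _; rewrite IHn // ltnW // ltnS.
Qed.

(* There are [m] urns, each with compartments [false] and [true]. *)
Definition compartment (m : nat) : finType := ('I_m * bool)%type.

(* Marbles are placed in the order 0, ..., n.-1; item [i] of the tuple is the
   compartment receiving marble [i]. *)
Definition placement (m n : nat) : finType := n.-tuple (compartment m).

Section Urns.

Variable m : nat.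
Implicit Types (A : {set compartment m}) (c : compartment m) (u v : 'I_m).

Definition used (s : seq (compartment m)) : {set compartment m} :=
  [set c in s].

Definition opened A u : bool := [exists b, (u, b) \in A].

Definition filled A u : bool := [forall b, (u, b) \in A].

(* [A] is the set of compartments used so far. The two conjuncts are the only
   restrictions: the first marble, and any marble put in a compartment of a
   filled urn, satisfy both. *)
Definition legal_move A c : bool :=
  ((c \in A) ==> ((c.1, ~~ c.2) \in A)) &&
  (~~ opened A c.1 ==> [forall u, opened A u ==> filled A u]).

Lemma legal_move_first c : legal_move set0 c.
Proof.
rewrite /legal_move inE /=; apply/implyP => _; apply/forallP => u.
by apply/implyP => /existsP[b]; rewrite inE.
Qed.

Lemma legal_move_filled A c : filled A c.1 -> legal_move A c.
Proof.
move=> /forallP fA; rewrite /legal_move fA implybT /=.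
suff -> : opened A c.1 by [].
by apply/existsP; exists true.
Qed.

Definition admissible n (p : placement m n) : bool :=
  [forall i : 'I_n, legal_move (used (take i p)) (tnth p i)].

(* [sigma] permutes the urns; [tau u] tells whether the compartments of [u]
   are swapped. *)
Definition relabel (sigma : {perm 'I_m}) (tau : {ffun 'I_m -> bool}) c :
    compartment m :=
  (sigma c.1, tau c.1 (+) c.2).

Definition same_arrangement n : rel (placement m n) :=
  fun p q => [exists sigma, exists tau, q == map_tuple (relabel sigma tau) p].

Lemma same_arrangement_equiv n : equivalence_rel (@same_arrangement n).
Proof.
apply/equivalence_relP; split=> [p | p q].
  apply/existsP; exists 1%g; apply/existsP; exists [ffun=> false].
  apply/eqP/val_inj; rewrite /= -[LHS]map_id; apply: eq_map => -[u b].
  by rewrite /relabel /= perm1 ffunE.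
have sym (x y : placement m n) : same_arrangement x y -> same_arrangement y x.
  case/existsP=> sigma /existsP[tau /eqP->].
  apply/existsP; exists sigma^-1%g.
  apply/existsP; exists [ffun u => tau (sigma^-1%g u)].
  apply/eqP/val_inj; rewrite /= -map_comp -[LHS]map_id.
  by apply: eq_map => -[u b]; rewrite /relabel /= ffunE permK addKb.
have trans (x y z : placement m n) :
    same_arrangement x y -> same_arrangement y z -> same_arrangement x z.
  case/existsP=> s1 /existsP[t1 /eqP->] /existsP[s2 /existsP[t2 /eqP->]].
  apply/existsP; exists (s1 * s2)%g.
  apply/existsP; exists [ffun u => t2 (s1 u) (+) t1 u].
  apply/eqP/val_inj; rewrite /= -map_comp; apply: eq_map => -[u b].
  by rewrite /relabel /= permM ffunE addbA.
move=> pq r; apply/idP/idP; last exact: trans.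
by apply: trans; apply: sym.
Qed.

Definition all_arrangements n : {set {set placement m n}} :=
  equivalence_partition (@same_arrangement n)
    [set p : placement m n | admissible p].

Definition arrangements n k : {set {set placement m n}} :=
  equivalence_partition (@same_arrangement n)
    [set p : placement m n | admissible p & #|used p| == k].

(* Recall that [index x s = size s] when [x] does not occur in [s]; in
   particular a canonical placement leaves no gap below a used urn or
   compartment. *)
Definition canonical (s : seq (compartment m)) : bool :=
  let urns := [seq c.1 | c <- s] in
  [forall u : 'I_m, forall v : 'I_m,
     (u < v) && (v \in urns) ==> (index u urns < index v urns)] &&
  [forall u : 'I_m,
     ((u, true) \in s) ==> (index (u, false) s < index (u, true) s)].

End Urns.

(* Main.v *)
Require Import Defs.
From mathcomp Require Import all_boot.
From mathcomp Require Import perm zify.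

Set Implicit Arguments.
Unset Strict Implicit.
Unset Printing Implicit Defensive.

(** Number the compartments of the urns by [code (u, b) = 2 * u + b]. A placement
that is both admissible and canonical (a standard placement) always uses an
initial segment of this numbering, because urns, and compartments within an
urn, are opened in order and no urn is opened while another is half full.
When [k] compartments are used, the next marble either enters one of the
[2 * k./2] compartments of the filled urns or opens the compartment of code
[k]: this is [legal_canonical_rcons]. Adding the last marble to a standard
placement in all possible ways therefore reproduces the two terms of the
recurrence of [S2] ([card_standard]); the hypothesis [n <= m.*2] guarantees
that a compartment of code [k] is still available.

It remains to see that every class of admissible placements contains exactly
one standard placement. Existence ([standard_exists]) is by induction on the
number of marbles: legality forces a new compartment to be either the partner
of the half-filled one, or in an untouched urn, and an untouched urn can be
renamed and flipped without moving the earlier marbles. Uniqueness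
([standard_rigid]) holds because the code of a newly opened compartment is
determined by how many have been opened before, so an injective relabelling
between standard placements fixes every compartment in use.

For the Bessel--Bell numbers, let [continuations n j] be the number of ways to
place [n] further marbles once [j] compartments are used, so that
[continuations n 0] is the sum of [S2 n k] over [k]. From no compartment the
first two marbles can only fill one urn, so that
[continuations n.+2 0 = continuations n 2]. Starting from one more filled urn
adds 2 choices for every marble; selecting the marbles that use these 2 extra
choices gives the binomial sum ([continuations_shift]). *)

(** * Sums of Bessel--Stirling numbers *)

Fixpoint continuations (n j : nat) : nat :=
  if n is n'.+1 then 2 * j./2 * continuations n' j + continuations n' j.+1
  else 1.

Lemma S2_gt n k : n < k -> S2 n k = 0.
Proof.
elim: n k => [|n IHn] [|k] //= ltnk.
by rewrite !IHn ?muln0 // ltnW.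
Qed.

(** Both sides count the placements of [n + j] marbles, the left one according
to the number [k] of compartments used by the first [n]. *)
Lemma sum_S2_continuations n j :
  \sum_(k < n.+1) S2 n k * continuations j k = continuations (n + j) 0.
Proof.
elim: n j => [|n IHn] j; first by rewrite big_ord1 mul1n.
rewrite addSnnS -IHn /=.
under eq_bigr do rewrite mulnDl.
rewrite big_split /= big_ord_recr /= S2_gt // muln0 mul0n addn0.
rewrite [X in _ + X]big_ord_recl /= mul0n add0n -big_split /=.
apply: eq_bigr => k _; rewrite mulnDr mulnCA mulnA [X in X + _]mulnC.
by rewrite mulnCA mulnA.
Qed.

(** With two more compartments in use there is one more filled urn, whose two
compartments are open to every marble at all later times, while the choices
outside this urn are those of the smaller configuration.
In the sum, [k] is the number of marbles that avoid this urn. *)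
Lemma continuations_shift n j :
  continuations n j.+2 =
  \sum_(k < n.+1) 'C(n, k) * 2 ^ (n - k) * continuations k j.
Proof.
elim: n j => [|n IHn] j; first by rewrite big_ord1.
have pascal : \sum_(k < n.+2) 'C(n.+1, k) * 2 ^ (n.+1 - k) * continuations k j =
    \sum_(k < n.+1) 'C(n, k) * 2 ^ (n - k) * continuations k.+1 j +
    2 * \sum_(k < n.+1) 'C(n, k) * 2 ^ (n - k) * continuations k j.
  (* Pascal's rule, with the index shifted by one in the first sum; the extra
     last term of the second sum vanishes since 'C(n, n.+1) = 0. *)
  transitivity (\sum_(k < n.+1) 'C(n, k) * 2 ^ (n - k) * continuations k.+1 j +
      \sum_(k < n.+2) 'C(n, k) * 2 ^ (n.+1 - k) * continuations k j).
    rewrite !(big_ord_recl n.+1) !bin0 addnCA; congr (_ + _).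
    rewrite -big_split; apply: eq_bigr => k _ /=.
    by rewrite binS !mulnDl addnC.
  congr (_ + _); rewrite big_ord_recr /= bin_small // !mul0n addn0 big_distrr.
  apply: eq_bigr => k _ /=; rewrite subSn ?leq_ord // expnS.
  by rewrite mulnCA !mulnA.
rewrite pascal /= !IHn mulnS mulnDl -addnA [LHS]addnC; congr (_ + _).
rewrite big_distrr /= -big_split /=; apply: eq_bigr => k _ /=.
by rewrite mulnDr; congr (_ + _); rewrite mulnCA.
Qed.

(** [continuations n.+2 0] computes to [continuations n 2], which turns
[continuations_shift] into the defining recurrence. *)
Lemma bessel_bell_sum_S2 n : \sum_(k < n.+1) S2 n k = bessel_bell n.
Proof.
transitivity (continuations n 0).
  by rewrite -[n in RHS]addn0 -sum_S2_continuations; under [RHS]eq_bigr do rewrite muln1.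
apply: (bessel_bell_unique (a := continuations^~ 0)); split=> // i.
exact: (continuations_shift i 0).
Qed.

(** * Equivalence classes and systems of representatives *)

(** [C] only has to pick out one representative per class inside [D]: counting
classes then amounts to counting the elements of [D :&: C]. *)
Lemma card_equivalence_partition (T : finType) (R : rel T) (D C : {set T}) :
    equivalence_rel R ->
    (forall x, x \in D -> exists2 y, y \in D :&: C & R x y) ->
    {in D :&: C &, forall x y, R x y -> x = y} ->
  #|equivalence_partition R D| = #|D :&: C|.
Proof.
move=> /equivalence_relP[refl trans] repr uniq.
pose cls x := [set y in D | R x y].
have -> : equivalence_partition R D = cls @: (D :&: C).
  apply/setP=> X; apply/imsetP/imsetP => -[x xD ->].
    have [y yDC Rxy] := repr x xD; exists y => //.
    by apply/setP=> z; rewrite !inE (trans _ _ Rxy).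
  by exists x => //; case/setIP: xD.
rewrite card_in_imset // => x y xDC yDC /setP/(_ y).
rewrite !inE refl; case/setIP: (yDC) => -> _ /= Rxy; exact: uniq.
Qed.

(** * Order of first occurrence *)

(** Canonicity is a conjunction of such conditions, both for urns and for
compartments, and each of them evolves simply when a letter is appended. *)
Definition before (T : eqType) (s : seq T) (x y : T) : bool :=
  (y \in s) ==> (index x s < index y s).

Lemma before_rcons (T : eqType) (s : seq T) (c x y : T) :
  before (rcons s c) x y =
  before s x y && ((y == c) ==> (y \in s) || (x \in s)).
Proof.
rewrite /before -cats1 !index_cat mem_cat inE.
case ys: (y \in s) => /=.
  rewrite implybT andbT; case: ifP => // xs.
  have ltys : index y s < size s by rewrite index_mem.
  have := index_size x s; have := memNindex (negbT xs); lia.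
case: eqVneq => //= _; rewrite addn0.
case: ifP => xs; first by rewrite index_mem.
by rewrite ltnNge leq_addr.
Qed.

(** * The numbering of compartments and the next move *)

Section Compartments.

Variable m : nat.
Implicit Types (A : {set compartment m}) (c d : compartment m) (k : nat).
Implicit Types (s : seq (compartment m)) (u v : 'I_m).

Definition code c : nat := c.1.*2 + c.2.

Definition initial k : {set compartment m} := [set c | code c < k].

Lemma code_inj : injective code.
Proof.
move=> [u b] [v d] /= E; have ub : u = v.
  by apply/val_inj; move: E; rewrite /code /=; case: b d => [] [] /=; lia.
by move: E; rewrite ub /code /= => /addnI; case: b d => [] [].
Qed.

Lemma code_lt c : code c < m.*2.
Proof. by case: c => u b; rewrite /code /=; have := ltn_ord u; case: b => /=; lia. Qed.

Lemma code_onto k : k < m.*2 -> exists c, code c = k.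
Proof.
move=> ltk; have ltkm : k./2 < m by lia.
by exists (Ordinal ltkm, odd k); rewrite /code /= addnC odd_double_half.
Qed.

Lemma initialS c : initial (code c).+1 = c |: initial (code c).
Proof.
by apply/setP=> d; rewrite !inE ltnS leq_eqVlt (inj_eq code_inj).
Qed.

Lemma card_initial k : k <= m.*2 -> #|initial k| = k.
Proof.
elim: k => [_|k IHk lek]; first by apply: eq_card0 => c; rewrite !inE.
have [c ck] := code_onto lek.
by rewrite -ck initialS cardsU1 !inE ltnn ck IHk // ltnW.
Qed.

(** The possible next compartments of a standard placement using exactly the
compartments of code less than [k]: one in the [k./2] filled urns, or the next
unused one. *)
Definition growth_step k c : bool := (code c < k./2.*2) || (code c == k).

Lemma growth_initial k c :
  growth_step k c -> c |: initial k = initial (k + (code c == k)).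
Proof.
case: eqVneq => [<- _|neq]; first by rewrite addn1 initialS.
rewrite /growth_step (negPf neq) orbF addn0 => ltc; apply/setUidPr.
by rewrite sub1set inE; lia.
Qed.

Lemma opened_initial k u : opened (initial k) u = (u.*2 < k).
Proof.
apply/existsP/idP => [[b]|ltk]; last by exists false; rewrite inE /code addn0.
by rewrite inE /code /=; lia.
Qed.

Lemma filled_initial k u : filled (initial k) u = (u.*2.+1 < k).
Proof.
apply/forallP/idP => [/(_ true)|ltk b]; first by rewrite inE /code addn1.
by rewrite inE /code /=; case: b => /=; lia.
Qed.

(** The urn of number [k./2] is half full when [k] is odd. The urn [v], not
opened yet, only serves to ensure that [k./2 < m]. *)
Lemma all_filled_initial k v : k <= v.*2 ->
  [forall u, opened (initial k) u ==> filled (initial k) u] = ~~ odd k.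
Proof.
move=> lek; apply/forallP/idP => [fill|evk u]; last first.
  by rewrite opened_initial filled_initial; apply/implyP; lia.
apply/negP => oddk; have ltkm : k./2 < m by have := ltn_ord v; lia.
have := fill (Ordinal ltkm); rewrite opened_initial filled_initial /=.
by move/implyP; lia.
Qed.

(** Without canonicity, legality only adds the freedom to open any untouched urn,
by any of its compartments, when all the opened urns are filled. *)
Lemma legal_moveE k c : legal_move (initial k) c =
  growth_step k c || [&& k <= c.1.*2 & ~~ odd k].
Proof.
rewrite /legal_move !inE opened_initial /growth_step /code.
case: c => v b /=; have [ltv|gev] := ltnP (v.*2) k => /=.
  by rewrite andbT orbF; case: b => /=; apply/implyP/idP; lia.
rewrite (all_filled_initial gev).
by case: b => /=; apply/andP/orP => -[]; lia.
Qed.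

Definition urns s : seq 'I_m := [seq c.1 | c <- s].

Lemma canonical_before s : canonical s =
  [forall u : 'I_m, forall v : 'I_m, (u < v) ==> before (urns s) u v] &&
  [forall u, before s (u, false) (u, true)].
Proof.
congr (_ && _); apply: eq_forallb => u; apply: eq_forallb => v.
by rewrite /before; case: (u < v).
Qed.

Lemma canonical_rcons s c : canonical (rcons s c) =
  [&& canonical s,
      [forall u : 'I_m, (u < c.1) ==> (c.1 \in urns s) || (u \in urns s)]
    & c.2 ==> (c \in s) || ((c.1, false) \in s)].
Proof.
rewrite !canonical_before /urns map_rcons.
apply/andP/and3P => [[/forallP fu /forallP fb]|].
  split; first (apply/andP; split; apply/forallP => u).
  - apply/forallP => v; have /forallP/(_ v)/implyP h := fu u.
    by apply/implyP => /h; rewrite before_rcons => /andP[].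
  - by have := fb u; rewrite before_rcons => /andP[].
  - apply/forallP => u; apply/implyP => ltu; have /forallP/(_ c.1) := fu u.
    by rewrite ltu before_rcons eqxx => /andP[].
  case: c fb {fu} => v b fb; apply/implyP => /= bT; move: fb; rewrite bT => fb.
  by have := fb v; rewrite before_rcons eqxx => /andP[].
case=> /andP[/forallP fu /forallP fb] /forallP hu hb; split.
  apply/forallP => u; apply/forallP => v; apply/implyP => ltuv.
  have /forallP/(_ v) := fu u; rewrite ltuv before_rcons => /= ->.
  by apply/implyP => /eqP vc; have := hu u; rewrite -vc ltuv.
apply/forallP => u; rewrite before_rcons fb; apply/implyP => /eqP uc.
by move: hb; rewrite -uc.
Qed.

Lemma mem_initial s k c : used s = initial k -> (c \in s) = (code c < k).
Proof. by move=> sk; have := in_set (mem s) c; rewrite -/(used s) sk inE => ->. Qed.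

Lemma urns_initial s k u : used s = initial k -> (u \in urns s) = (u.*2 < k).
Proof.
move=> sk; rewrite -opened_initial -sk.
apply/mapP/existsP => [[[v b] cs /= ->]|[b]]; first by exists b; rewrite inE.
by rewrite inE; exists (u, b).
Qed.

(** Legality and canonicity together leave no choice in opening a new
compartment: among untouched urns, canonicity imposes the first one, and its
compartment [false]. *)
Lemma legal_canonical_rcons s k c : used s = initial k -> canonical s ->
  legal_move (used s) c && canonical (rcons s c) = growth_step k c.
Proof.
move=> sk cs; rewrite sk legal_moveE canonical_rcons cs /=.
rewrite (mem_initial _ sk) (mem_initial _ sk) (urns_initial _ sk).
case: c => v b /=; apply/and3P/idP => [[+ /forallP fu hb]|g].
  case/orP=> // /andP[lek evk]; rewrite /growth_step /code /=.
  move: hb; rewrite /code /=; case: b => /=; first by lia.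
  (* An urn [v] beyond [k./2] would be opened before the urn [k./2]. *)
  move=> _; rewrite addn0; apply/orP; right; apply: contraT => neq.
  have ltkm : k./2 < m by have := ltn_ord v; lia.
  by have := fu (Ordinal ltkm); rewrite (urns_initial _ sk) /=; lia.
have gb := g; rewrite /growth_step /code /= in gb; split; first by rewrite g.
  apply/forallP => u; rewrite (urns_initial _ sk); apply/implyP.
  by case: b gb {g} => /=; lia.
by rewrite /code /=; case: b gb {g} => /=; lia.
Qed.

Lemma used_rcons s c : used (rcons s c) = c |: used s.
Proof. by apply/setP => d; rewrite !inE mem_rcons. Qed.

Lemma relabel_inj sigma tau : injective (@relabel m sigma tau).
Proof.
by move=> [u b] [v d] [/perm_inj-> /addbI ->].
Qed.

Lemma used_map (f : compartment m -> compartment m) s :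
  used (map f s) = f @: used s.
Proof.
apply/setP => d; rewrite inE; apply/mapP/imsetP => -[c cs ->];
  by exists c => //; move: cs; rewrite inE.
Qed.

Lemma legal_move_relabel sigma tau A c :
  legal_move (relabel sigma tau @: A) (relabel sigma tau c) = legal_move A c.
Proof.
set f := relabel sigma tau.
have fE d : (f d \in f @: A) = (d \in A) by rewrite mem_imset //; apply: relabel_inj.
have swapE v b : (sigma v, b) = f (v, tau v (+) b) by rewrite /f /relabel /= addKb.
have opE v : opened (f @: A) (sigma v) = opened A v.
  apply/existsP/existsP => -[b vb]; first by exists (tau v (+) b); rewrite -fE -swapE.
  by exists (tau v (+) b); rewrite swapE addKb fE.
have fiE v : filled (f @: A) (sigma v) = filled A v.
  apply/forallP/forallP => vA b; last by rewrite swapE fE.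
  by have := vA (tau v (+) b); rewrite swapE addKb fE.
rewrite /legal_move fE [(f c).1]/= opE [((f c).1, ~~ (f c).2)]swapE fE.
rewrite -addbN addKb; congr (_ && (_ ==> _)).
apply/forallP/forallP => all_f u; first by rewrite -opE -fiE.
by rewrite -[u](permKV sigma) opE fiE.
Qed.

(** A legal move becomes a [growth_step] after exchanging the urn it opens with
the first untouched one, and flipping it if necessary; neither of these urns
contains a marble yet. *)
Lemma legal_move_normalize k c : legal_move (initial k) c ->
  exists sigma tau,
    {in initial k, relabel sigma tau =1 id} /\ growth_step k (relabel sigma tau c).
Proof.
rewrite legal_moveE => /orP[g|/andP[lek evk]].
  exists 1%g, [ffun=> false].
  have id1 d : relabel 1 [ffun=> false] d = d.
    by case: d => v b; rewrite /relabel /= perm1 ffunE.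
  by rewrite id1; split=> // d _.
case: c lek => v b /= lek; have ltkm : k./2 < m by have := ltn_ord v; lia.
pose w := Ordinal ltkm; exists (tperm v w), [ffun u => (u == v) && b].
split=> [[u d]|]; last first.
  rewrite /relabel /= tpermL ffunE eqxx /= addbb /growth_step /code /=.
  by apply/orP; right; lia.
rewrite inE /code /relabel /= ffunE => ltk.
have [neqv neqw] : v != u /\ w != u.
  by split; apply: contraTneq ltk => <- /=; rewrite /w /=; lia.
by rewrite tpermD // eq_sym (negPf neqv).
Qed.

End Compartments.

(** * Counting standard placements *)

Section Placements.

Variable m : nat.

Lemma rcons_tuple_bij n :
  bijective (fun pc : placement m n * compartment m => rcons_tuple pc.1 pc.2).
Proof.
apply: inj_card_bij => [[p c] [q d] /= /(congr1 val) /rcons_inj [/val_inj-> ->] //|].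
by rewrite card_prod !card_tuple expnSr.
Qed.

Lemma rcons_tuple_onto n (p : placement m n.+1) :
  exists q c, p = rcons_tuple (q : placement m n) c.
Proof.
by have [g _ gK] := rcons_tuple_bij n; exists (g p).1, (g p).2; rewrite gK.
Qed.

Lemma admissible_rcons n (p : placement m n) c :
  admissible (rcons_tuple p c) = admissible p && legal_move (used p) c.
Proof.
have takeE i : i <= n -> take i (rcons p c) = take i p.
  by move=> lei; rewrite -cats1 takel_cat // size_tuple.
apply/forallP/andP => [adm|[/forallP adm lc] i].
  split; last first.
    have := adm ord_max.
    by rewrite (tnth_nth c) /= nth_rcons takeE // take_oversize size_tuple // ltnn eqxx.
  apply/forallP => i; have := adm (widen_ord (leqnSn n) i).
  by rewrite !(tnth_nth c) /= takeE 1?ltnW // nth_rcons size_tuple ltn_ord.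
rewrite (tnth_nth c) /= takeE ?leq_ord // nth_rcons size_tuple.
have := leq_ord i; rewrite leq_eqVlt => /orP[/eqP->|lti].
  by rewrite ltnn eqxx take_oversize // size_tuple.
by rewrite lti; have := adm (Ordinal lti); rewrite (tnth_nth c).
Qed.

Definition standard n (p : placement m n) : bool := admissible p && canonical p.

Lemma canonical_belast (s : seq (compartment m)) c :
  canonical (rcons s c) -> canonical s.
Proof. by rewrite canonical_rcons => /andP[]. Qed.

Lemma card_growth k c : k <= m.*2 -> growth_step k c ->
  #|c |: initial m k| = k + (code c == k).
Proof.
move=> lek g; rewrite growth_initial // card_initial //.
by case: eqVneq => [<-|_]; rewrite ?addn0 // addn1 code_lt.
Qed.

Lemma standard_used n (p : placement m n) :
  standard p -> used p = initial m #|used p|.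
Proof.
suff ex_k : standard p -> exists2 k, k <= m.*2 & used p = initial m k.
  by case/ex_k=> k lek ->; rewrite card_initial.
elim: n p => [|n IHn] p.
  by exists 0 => //; rewrite (tuple0 p); apply/setP => c; rewrite !inE.
have [q [c ->]] := rcons_tuple_onto p.
rewrite /standard admissible_rcons => /andP[/andP[aq lc] can].
have cq := canonical_belast can.
have [|k lek qk] := IHn q; first by rewrite /standard aq.
have g : growth_step k c by rewrite -(legal_canonical_rcons c qk cq) lc.
exists (k + (code c == k)); last by rewrite used_rcons qk growth_initial.
by case: eqVneq => [<-|_]; rewrite ?addn0 // addn1 code_lt.
Qed.

(** This makes standard placements a generating tree in which the offspring of a
node depends on its number of used compartments alone. *)
Lemma standard_rcons n (p : placement m n) c :
  standard (rcons_tuple p c) = standard p && growth_step #|used p| c.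
Proof.
rewrite {1}/standard admissible_rcons -andbA.
case sp: (standard p) => /=; last first.
  apply: contraFF sp => /and3P[ap _ cc].
  by rewrite /standard ap (canonical_belast cc).
case/andP: (sp) => -> cp /=.
by rewrite (legal_canonical_rcons c (standard_used sp) cp).
Qed.

Lemma card_used n (p : placement m n) : #|used p| <= n.
Proof. by rewrite cardsE (leq_trans (card_size _)) // size_tuple. Qed.

Lemma card_set_sum (T : finType) (P : pred T) : #|[set x | P x]| = \sum_x P x.
Proof.
rewrite cardsE -sum1_card big_mkcond; apply: eq_bigr => x _.
by rewrite unfold_in; case: (P x).
Qed.

Lemma sum_extensions n (p : placement m n) k : n < m.*2 ->
  \sum_c (standard (rcons_tuple p c) && (#|used (rcons_tuple p c)| == k)) =
  2 * k./2 * (standard p && (#|used p| == k)) +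
  (standard p && (#|used p|.+1 == k)).
Proof.
move=> ltn; case sp: (standard p); last first.
  by rewrite muln0; apply: big1 => c _; rewrite standard_rcons sp.
set j := #|used p|; have ltj : j < m.*2 := leq_ltn_trans (card_used p) ltn.
(* The two kinds of [growth_step] exclude each other: [j] is not less than
   [j./2.*2]. Only the second increases the number of used compartments. *)
have letter c : (standard (rcons_tuple p c) && (#|used (rcons_tuple p c)| == k)) =
    (code c < j./2.*2) * (j == k) + (code c == j) * (j.+1 == k) :> nat.
  rewrite standard_rcons sp used_rcons /=.
  case g: (growth_step j c) => /=; last first.
    by move: g; rewrite /growth_step => /norP[/negPf-> /negPf->].
  rewrite (standard_used sp) card_growth // ?(ltnW ltj) //.
  move: g; rewrite /growth_step; case: (eqVneq (code c) j) => [-> _|_] /=.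
    by rewrite addn1 mul1n (_ : (j < j./2.*2) = false) //; lia.
  by rewrite orbF addn0 => ->; rewrite mul1n addn0.
rewrite (eq_bigr _ (fun c _ => letter c)) big_split -!big_distrl /=.
rewrite -!card_set_sum card_initial; last by lia.
have [c cj] := code_onto ltj.
have -> : [set d : compartment m | code d == j] = [set c].
  by apply/setP=> d; rewrite !inE -cj (inj_eq (@code_inj m)).
rewrite cards1 mul1n; congr (_ + _); case: eqVneq => [->|_]; last by rewrite !muln0.
by rewrite mul2n.
Qed.

Lemma card_standard n k : n <= m.*2 ->
  #|[set p : placement m n | standard p & #|used p| == k]| = S2 n k.
Proof.
elim: n k => [|n IHn] k len.
  have used0 (p : placement m 0) : #|used p| = 0.
    by apply/eqP; rewrite -leqn0 card_used.
  have std0 (p : placement m 0) : standard p.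
    rewrite /standard (tuple0 p) canonical_before; apply/and3P; split.
    - by apply/forallP => -[].
    - by apply/forallP => u; apply/forallP => v; rewrite implybT.
    - by apply/forallP.
  rewrite card_set_sum (eq_bigr (fun=> (k == 0) : nat)); last first.
    by move=> p _; rewrite std0 used0 eq_sym.
  by rewrite sum_nat_const card_tuple mul1n.
rewrite card_set_sum (reindex _ (onW_bij _ (rcons_tuple_bij n))) /=.
rewrite -(pair_bigA _ (fun p c => (standard (rcons_tuple p c) &&
  (#|used (rcons_tuple p c)| == k) : nat))) /=.
rewrite (eq_bigr _ (fun p _ => sum_extensions p k len)) big_split -big_distrr /=.
rewrite -!card_set_sum IHn ?(ltnW len) //; congr (_ + _).
case: k => [|k]; last exact: IHn (ltnW len).
by apply: eq_card0 => p; rewrite inE andbF.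
Qed.

Lemma card_all_standard n : n <= m.*2 ->
  #|[set p : placement m n | standard p]| = bessel_bell n.
Proof.
move=> len; rewrite -bessel_bell_sum_S2.
under [RHS]eq_bigr => k _ do rewrite -card_standard // card_set_sum.
rewrite exchange_big card_set_sum; apply: eq_bigr => p _ /=.
have ltu : #|used p| < n.+1 by rewrite ltnS card_used.
rewrite (bigD1 (Ordinal ltu)) //= eqxx andbT big1 ?addn0 // => k neqk.
by rewrite eq_sym -(inj_eq val_inj) /= in neqk; rewrite (negPf neqk) andbF.
Qed.

(** * Standard representatives of arrangements *)

Lemma admissible_relabel n (p : placement m n) sigma tau :
  admissible (map_tuple (relabel sigma tau) p) = admissible p.
Proof.
apply: eq_forallb => i.
by rewrite tnth_map /= -map_take used_map legal_move_relabel.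
Qed.

Lemma map_rcons_tuple n f (p : placement m n) c :
  map_tuple f (rcons_tuple p c) = rcons_tuple (map_tuple f p) (f c) :> placement m n.+1.
Proof. by apply/val_inj; rewrite /= map_rcons. Qed.

(** Suppose that [f] fixes all compartments used so far. If the next compartment
[c] is new, then so is [f c], and both have as code the number of compartments
used so far; hence [f c = c]. *)
Lemma standard_rigid n (p : placement m n) f : injective f ->
  standard p -> standard (map_tuple f p) -> map_tuple f p = p.
Proof.
move=> f_inj; elim: n p => [|n IHn] p; first by rewrite (tuple0 p) [LHS]tuple0.
have [q [c ->]] := rcons_tuple_onto p.
rewrite map_rcons_tuple !standard_rcons => /andP[sq gc] /andP[sfq].
have fq := IHn q sq sfq; rewrite fq => gfc.
have fq_seq : map f q = q := congr1 val fq.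
suff -> : f c = c by [].
case cq: (c \in tval q).
  by have /eq_in_map/(_ c cq) : map f q = map id q by rewrite map_id.
have fcq : (f c \in tval q) = false by rewrite -fq_seq mem_map.
move: gc gfc; rewrite /growth_step; have used_q := standard_used sq.
move/negbT: cq; move/negbT: fcq; rewrite !(mem_initial _ used_q).
by move=> le1 le2 g1 g2; apply: (@code_inj m); lia.
Qed.

Lemma same_arrangementP n (p q : placement m n) :
  reflect (exists sigma tau, q = map_tuple (relabel sigma tau) p)
          (same_arrangement p q).
Proof.
apply: (iffP existsP) => [[sigma /existsP[tau /eqP->]]|[sigma [tau ->]]].
  by exists sigma, tau.
by exists sigma; apply/existsP; exists tau.
Qed.

Lemma standard_unique n (p q : placement m n) :
  standard p -> standard q -> same_arrangement p q -> p = q.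
Proof.
move=> sp sq /same_arrangementP[sigma [tau qE]].
by rewrite qE standard_rigid // -?qE //; apply: relabel_inj.
Qed.

Lemma admissible_same n (p q : placement m n) :
  same_arrangement p q -> admissible q = admissible p.
Proof. by case/same_arrangementP=> sigma [tau ->]; apply: admissible_relabel. Qed.

Lemma card_used_same n (p q : placement m n) :
  same_arrangement p q -> #|used q| = #|used p|.
Proof.
case/same_arrangementP=> sigma [tau ->].
by rewrite used_map card_imset //; apply: relabel_inj.
Qed.

(** After the first marbles have been brought to standard form, the last one needs
at most the correction of [legal_move_normalize], which leaves them in place. *)
Lemma standard_exists n (p : placement m n) :
  admissible p -> exists2 q, same_arrangement p q & standard q.
Proof.
suff ex_can : admissible p -> exists2 q, same_arrangement p q & canonical q.
  move=> ap; have [q pq cq] := ex_can ap.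
  by exists q; rewrite // /standard (admissible_same pq) ap.
elim: n p => [|n IHn] p.
  move=> _; exists p; first by have [] := same_arrangement_equiv p p p.
  rewrite (tuple0 p) canonical_before; apply/andP; split.
    by apply/forallP => u; apply/forallP => v; rewrite implybT.
  exact/forallP.
have [p' [c ->]] := rcons_tuple_onto p; rewrite admissible_rcons => /andP[ap lc].
have [q pq cq] := IHn p' ap.
have sq : standard q by rewrite /standard (admissible_same pq) ap.
have used_q := standard_used sq.
have /same_arrangementP[sigma [tau qE]] := pq; pose f := relabel sigma tau.
have lfc : legal_move (initial m #|used q|) (f c).
  by rewrite -used_q qE used_map legal_move_relabel.
have [sigma' [tau' [fix_q gc]]] := legal_move_normalize lfc.
pose g := relabel sigma' tau'.
have gq : map_tuple g q = q.
  apply/val_inj; rewrite /= -[RHS]map_id; apply/eq_in_map => d dq.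
  by apply: fix_q; rewrite inE -(mem_initial d used_q).
exists (rcons_tuple q (g (f c))).
  have trans := @same_arrangement_equiv m n.+1.
  have step1 : same_arrangement (rcons_tuple p' c) (rcons_tuple q (f c)).
    by apply/same_arrangementP; exists sigma, tau; rewrite map_rcons_tuple -qE.
  have step2 : same_arrangement (rcons_tuple q (f c)) (rcons_tuple q (g (f c))).
    by apply/same_arrangementP; exists sigma', tau'; rewrite map_rcons_tuple gq.
  by have [_ /(_ step1) ->] := trans (rcons_tuple p' c) (rcons_tuple q (f c))
       (rcons_tuple q (g (f c))).
by have := legal_canonical_rcons (g (f c)) used_q cq; rewrite gc => /andP[].
Qed.

End Placements.

Theorem theorem5p1 (m n : nat) (enough_urns : n <= m.*2) :
  [/\ (forall k : nat, #|arrangements m n k| = S2 n k),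
      (forall X : {set placement m n}, X \in all_arrangements m n ->
         exists! p : placement m n, p \in X /\ canonical p),
      (n < m.*2 -> forall p : placement m n, admissible p -> canonical p ->
         exists! c : compartment m,
           [/\ legal_move (used p) c, c \notin used p
             & canonical (rcons p c)])
    & #|all_arrangements m n| = bessel_bell n].
Proof.
have equiv := @same_arrangement_equiv m n.
pose C : {set placement m n} := [set p : placement m n | canonical p].
split.
- move=> k; rewrite -(card_standard k enough_urns) /arrangements.
  rewrite (@card_equivalence_partition _ _ _ C equiv).
  + by apply: eq_card => p; rewrite !inE /standard andbAC.
  + move=> p; rewrite inE => /andP[ap pk].
    have [q pq /andP[aq cq]] := standard_exists ap; exists q => //.
    by rewrite !inE aq cq (card_used_same pq) pk.
  + move=> p q; rewrite !inE => /andP[/andP[ap _] cp] /andP[/andP[aq _] cq].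
    by apply: standard_unique; apply/andP.
- move=> X /imsetP[x]; rewrite inE => ax ->.
  have [p xp /andP[ap cp]] := standard_exists ax.
  exists p; split=> [|q []]; first by rewrite !inE ap.
  rewrite !inE => /andP[aq xq] cq; apply: standard_unique; try exact/andP.
  by have [_ /(_ xp) <-] := equiv x p q.
(* The new compartment is the one whose code is the number of used ones. *)
- move=> ltn p ap cp; have sp : standard p by apply/andP.
  have used_p := standard_used sp; set k := #|used p| in used_p.
  have [c ck] : exists c : compartment m, code c = k.
    exact: code_onto (leq_ltn_trans (card_used p) ltn).
  have newE d : legal_move (used p) d && canonical (rcons p d) ->
      d \notin used p -> code d = k.
    by rewrite (legal_canonical_rcons d used_p cp) used_p inE /growth_step; lia.
  exists c; split=> [|d [ld nd cd]]; last first.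
    by apply: (@code_inj m); rewrite ck newE // ld.
  have : growth_step k c by rewrite /growth_step ck eqxx orbT.
  rewrite -(legal_canonical_rcons c used_p cp) => /andP[-> ->]; split=> //.
  by rewrite used_p inE ck ltnn.
rewrite -(card_all_standard enough_urns) /all_arrangements.
rewrite (@card_equivalence_partition _ _ _ C equiv).
- by apply: eq_card => p; rewrite !inE.
- move=> p; rewrite inE => ap.
  have [q pq /andP[aq cq]] := standard_exists ap; exists q => //.
  by rewrite !inE aq cq.
move=> p q; rewrite !inE => /andP[ap cp] /andP[aq cq].
by apply: standard_unique; apply/andP.
Qed.
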